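(* Let $E\subset\mathfrak p$ be a $K$-invariant convex body, let $\mathfrak a\subset\mathfrak p$ be a maximal abelian subalgebra, and let $P=E\cap\mathfrak a$. Then all faces of $E$ are exposed if and only if all faces of $P$ are exposed.
   Context: Setting: $\mathfrak g$ is a real semisimple Lie algebra with Cartan involution $\theta$ and Cartan decomposition $\mathfrak g=\mathfrak k\oplus\mathfrak p$. $G$ is a connected real semisimple Lie group with Lie algebra $\mathfrak g$, and $K\subset G$ is a maximal compact subgroup with Lie algebra $\mathfrak k$. $K$ acts on $\mathfrak p$ by the adjoint representation, and $\langle\cdot,\cdot\rangle$ is the $K$-invariant scalar product on $\mathfrak p$ given by the restriction of the Killing form. Notation: a convex body is a (nonempty) compact convex set. A face of a convex body $C$ is a convex subset $F\subset C$ such that $x,y\in C$ and $\mathrm{relint}[x,y]\cap F\neq\emptyset$ imply $[x,y]\subset F$; faces are taken nonempty, and $C$ itself is a face. For a convex body $C$ in a Euclidean space $V$, a face $F$ of $C$ is exposed if there is $\beta\in V$ (possibly $0$) with $F=F_\beta(C):=\{x\in C:\langle x,\beta\rangle=\max_{y\in C}\langle y,\beta\rangle\}$. For $E$ one takes $V=\mathfrak p$, for $P$ one takes $V=\mathfrak a$. *)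

(* Defs.v *)
From HB Require Import structures.
From mathcomp Require Import all_boot all_order all_algebra.
From mathcomp Require Import all_classical all_reals all_analysis.

Set Implicit Arguments.
Unset Strict Implicit.
Unset Printing Implicit Defensive.
Import Order.TTheory GRing.Theory Num.Theory.
Import numFieldNormedType.Exports.

Local Open Scope classical_set_scope.
Local Open Scope ring_scope.

HB.mixin Record Vector_isLieAlgebra (R : fieldType) L of Vector R L := {
  lie : L -> L -> L ;
  lie_linearl : forall y, linear (lie ^~ y) ;
  lie_linearr : forall x, linear (lie x) ;
  liexx : forall x, lie x x = 0 ;
  lie_jacobi : forall x y z,
    lie x (lie y z) + lie y (lie z x) + lie z (lie x y) = 0
}.

#[short(type="lieAlgType")]
HB.structure Definition LieAlgebra (R : fieldType) :=
  {L of Vector_isLieAlgebra R L & Vector R L}.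

(* The norm only provides the topology of the finite-dimensional space, which
   does not depend on its choice. *)
#[short(type="normedLieAlgType")]
HB.structure Definition NormedLieAlgebra (R : numFieldType) :=
  {L of LieAlgebra R L & NormedModule R L}.

#[short(type="topoGroupType")]
HB.structure Definition TopoGroup := {G of Topological G & Group G}.

Section LieAlgebras.
Context {R : realFieldType} {L : lieAlgType R}.
Implicit Types (U V I a : {vspace L}) (x y : L).

Definition killing x y : R :=
  let b := vbasis {:L} in \tr (passmx.mxof b b (linfun (fun z => lie x (lie y z)))).

Definition lie_ideal I := forall x y, y \in I -> lie x y \in I.

Definition lie_span U V : {vspace L} :=
  <<[seq lie u v | u <- vbasis U, v <- vbasis V]>>%VS.

Definition lie_solvable U :=
  exists n, iter n (fun W => lie_span W W) U = 0%VS.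

Definition lie_semisimple := forall I, lie_ideal I -> lie_solvable I -> I = 0%VS.

Definition cartan_involution (theta : 'End(L)) :=
  [/\ forall x, theta (theta x) = x,
      forall x y, theta (lie x y) = lie (theta x) (theta y) &
      forall x, x != 0 -> 0 < - killing x (theta x)].

Definition cartan_k (theta : 'End(L)) : set L := [set x | theta x = x].
Definition cartan_p (theta : 'End(L)) : set L := [set x | theta x = - x].

Definition lie_abelian a := forall x y, x \in a -> y \in a -> lie x y = 0.

Definition maximal_abelian_in (S : set L) a :=
  [/\ lie_abelian a, [set` a] `<=` S &
      forall b : {vspace L}, lie_abelian b -> [set` b] `<=` S ->
        (a <= b)%VS -> b = a].

End LieAlgebras.

Section Smooth.
Context {R : realType}.

(* Meant for U open. On finite-dimensional spaces this is the usual C^n: the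
   iterated directional derivatives of order < n are differentiable on U, and
   those of order n are continuous on U. *)
Fixpoint Cn_on (V W : normedModType R) (n : nat) (U : set V) (f : V -> W) : Prop :=
  if n is m.+1 then
    (forall x, U x -> differentiable f x) /\ forall v, Cn_on m U ('D_v f)
  else forall x, U x -> {for x, continuous f}.

Definition smooth_on (V W : normedModType R) (U : set V) (f : V -> W) :=
  forall n, Cn_on n U f.

(* [cmap] is relevant only on [cdom], and [cinv] only on [cimg]. *)
Record chart (M : topologicalType) (V : normedModType R) := Chart {
  cdom : set M ;
  cmap : M -> V ;
  cinv : V -> M ;
  cimg := cmap @` cdom ;
  cdom_open : open cdom ;
  cimg_open : open cimg ;
  cmapK : forall x, cdom x -> cinv (cmap x) = x ;
  cmap_continuous : forall x, cdom x -> {for x, continuous cmap} ;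
  cinv_continuous : forall v, cimg v -> {for v, continuous cinv}
}.

Definition smooth_atlas (M : topologicalType) (V : normedModType R)
    (A : set (chart M V)) :=
  (forall x, exists2 c, A c & cdom c x) /\
  (forall c d, A c -> A d ->
     smooth_on (cimg c `&` cinv c @^-1` cdom d) (cmap d \o cinv c)).

Definition smooth_manifold (M : topologicalType) (V : normedModType R)
    (A : set (chart M V)) :=
  [/\ hausdorff_space M, @second_countable M & smooth_atlas A].

Definition smooth_curve (M : topologicalType) (V : normedModType R)
    (A : set (chart M V)) (gamma : R^o -> M) :=
  continuous gamma /\
  forall c, A c -> smooth_on (gamma @^-1` cdom c) (cmap c \o gamma).

Definition lie_group (G : topoGroupType) (V : normedModType R)
    (A : set (chart G V)) :=
  [/\ smooth_manifold A,
      continuous (fun z : G * G => (z.1 * z.2)%g),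
      continuous (fun x : G => x^-1)%g,
      forall a b c, A a -> A b -> A c ->
        smooth_on
          [set z : V * V | [/\ cimg a z.1, cimg b z.2 &
                               cdom c (cinv a z.1 * cinv b z.2)%g]]
          (fun z : V * V => cmap c (cinv a z.1 * cinv b z.2)%g) &
      forall a c, A a -> A c ->
        smooth_on [set v | cimg a v /\ cdom c (cinv a v)^-1%g]
                  (fun v => cmap c (cinv a v)^-1%g)].

End Smooth.

Section LieGroups.
Context {R : realType} {L : normedLieAlgType R} {G : topoGroupType}.
Implicit Types (A : set (chart G L)) (e : chart G L) (K : set G).

(* In this section e is a chart at the identity, and the tangent space of G at
   the identity is identified with L by means of the differential of e.  Then
   Ad e g is the differential at the identity of the conjugation by g. *)
Definition Ad e (g : G) (X : L) : L :=
  'D_X (fun v : L => cmap e (g * cinv e v * g^-1)%g) (cmap e 1%g).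

(* L is the Lie algebra of G: its bracket is [X, Y] = (d Ad)_1(X)(Y). *)
Definition lie_algebra_of A e :=
  [/\ A e, cdom e 1%g &
      forall X Y : L,
        is_derive (cmap e 1%g) X (fun v : L => Ad e (cinv e v) Y) (lie X Y)].

(* gamma is the one-parameter subgroup t |-> exp (t X). *)
Definition one_parameter_subgroup A e (gamma : R^o -> G) (X : L) :=
  [/\ smooth_curve A gamma,
      forall s t, gamma (s + t) = (gamma s * gamma t)%g &
      is_derive (0 : R^o) 1 (cmap e \o gamma) X].

(* {X | exp (t X) \in K for all t}, the Lie algebra of a closed subgroup K *)
Definition lie_algebra_of_subgroup A e K : set L :=
  [set X | exists2 gamma, one_parameter_subgroup A e gamma X & forall t, K (gamma t)].

Definition subgroup K :=
  [/\ K 1%g, forall x y, K x -> K y -> K (x * y)%g & forall x, K x -> K x^-1%g].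

Definition maximal_compact_subgroup K :=
  [/\ subgroup K, compact K &
      forall H : set G, subgroup H -> compact H -> K `<=` H -> H = K].

End LieGroups.

Section Convex.
Context {R : realType}.

Definition convex_body (V : normedModType R) (C : set V) :=
  [/\ C !=set0, compact C & convex_set (C : set (convex_lmodType V))].

Definition segment (V : lmodType R) (x y : V) : set V :=
  [set (1 - t) *: x + t *: y | t in [set t : R | 0 <= t <= 1]].

(* This is {x} when x = y, as it should. *)
Definition relint_segment (V : lmodType R) (x y : V) : set V :=
  [set (1 - t) *: x + t *: y | t in [set t : R | 0 < t < 1]].

Definition face (V : lmodType R) (C F : set V) :=
  [/\ F !=set0, F `<=` C, convex_set (F : set (convex_lmodType V)) &
      forall x y, C x -> C y -> relint_segment x y `&` F !=set0 ->
        segment x y `<=` F].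

(* V is the ambient Euclidean space, with scalar product ip. *)
Definition exposed_face (T : lmodType R) (ip : T -> T -> R) (V C F : set T) :=
  exists2 beta, V beta &
    F = [set x | C x /\ forall y, C y -> ip y beta <= ip x beta].

Definition all_faces_exposed (T : lmodType R) (ip : T -> T -> R) (V C : set T) :=
  forall F, face C F -> exposed_face ip V C F.

End Convex.

(* Main.v *)
From HB Require Import structures.
Require Import Defs.
From mathcomp Require Import all_boot all_order all_algebra.
From mathcomp Require Import all_classical all_reals all_analysis.
From mathcomp Require Import ring lra.

Set Implicit Arguments.
Unset Strict Implicit.
Unset Printing Implicit Defensive.
Import Order.TTheory GRing.Theory Num.Theory.
Import numFieldNormedType.Exports.
Import passmx.
Local Open Scope classical_set_scope.
Local Open Scope ring_scope.

(** Both directions compare a face with relative interior points: points x of a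
    convex set C such that, for a fixed d > 0, C contains x - d (y - x) for all y
    in C ([exists_relint]).  A face is determined by any such point of it
    ([face_relint_points]), and it contains every convex subset of the body that
    has one of its relative interior points in the face ([relint_face]).

    From E to P ([exposed_section]) nothing but convexity is at work.  If x is a
    relative interior point of a face F of P, the smallest face of E containing x
    meets a in F; a vector that exposes it, projected orthogonally to a, exposes F.

    From P to E ([exposed_of_section]) the group enters.  The main tool,
    [stable_meets_abelian], says that a nonempty compact subset C of p meets a as
    soon as its elements commute with a subset S of a and C is stable under the
    one-parameter groups exp (t ad X), for X in k commuting with S.  It rests on
    the computation behind the conjugacy of the maximal abelian subspaces: if x
    maximizes B(., b) on C, then the derivative of B(exp (t ad X) x, b) for
    X = [x, b] is B(X, X) at t = 0, so X = 0 since B is definite on k: x commutes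
    with b.  The set of maximizers is stable under the centralizer of b, so the
    argument can be repeated with all the elements of a basis of a.  It is applied three times to a face F of E:
    - to the orbit of a relative interior point of F under the compact group of
      linear isometries preserving E, which reduces to the case where F has a
      relative interior point x in a;
    - to the set C of maximizers on E of a vector b of a that exposes the face
      F `&` [set` a] of P; it shows that the maximum of b on E is the one on P, so
      that x lies in C and F is contained in C;
    - to the set of relative interior points of C, for a fixed d; it provides
      such a point in C `&` [set` a], which is contained in F, hence C is contained
      in F.
    Hence F = C is exposed by b.

    The Lie group is used only through the one-parameter groups exp (t ad X).  For
    X in k there is a one-parameter subgroup gamma of K with velocity X, and
    t |-> Ad (gamma t) solves c' = [X, c] ([Ad_flow]).  Since ad X is skew-symmetric
    for the inner product - B(x, theta y), the solutions of this equation are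
    unique and isometric; this makes Ad (gamma t) act as exp (t ad X) and shows
    that it is a linear isometry with inverse Ad (gamma (- t)). *)

(** * Identities between linear combinations *)

Section LinearCombinations.
Context {R : pzRingType} {V : lmodType R}.

(** Reified linear combinations, in which a vector is the position of an entry
    of a list. *)
Inductive lincomb :=
  | LVar of nat | LAdd of lincomb & lincomb | LOpp of lincomb
  | LScale of R & lincomb.

Fixpoint lineval (s : seq V) (e : lincomb) : V :=
  match e with
  | LVar i => nth 0 s i
  | LAdd a b => lineval s a + lineval s b
  | LOpp a => - lineval s a
  | LScale c a => c *: lineval s a
  end.

Fixpoint lincoef (e : lincomb) (i : nat) : R :=
  match e with
  | LVar j => if eqn j i then 1 else 0
  | LAdd a b => lincoef a i + lincoef b i
  | LOpp a => - lincoef a i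
  | LScale c a => c * lincoef a i
  end.

Fixpoint same_coefs (s : seq V) (a b : lincomb) (i : nat) : Prop :=
  if s is _ :: s' then lincoef a i = lincoef b i /\ same_coefs s' a b i.+1
  else True.

Lemma lineval_eq s a b : same_coefs s a b 0 -> lineval s a = lineval s b.
Proof.
have evalE e : lineval s e = \sum_(i < size s) lincoef e i *: s`_i.
  elim: e => [j|a1 IH1 a2 IH2|a1 IH|c a1 IH] /=.
  - have [js|sj] := ltnP j (size s).
      rewrite (bigD1 (Ordinal js))//= [eqn j j]eqxx scale1r big1 ?addr0// => i.
      rewrite -val_eqE/= eq_sym => ij.
      by case: ifP => [/eqnP ji|_]; [rewrite ji eqxx in ij|rewrite scale0r].
    rewrite nth_default// big1// => i _.
    case: ifP => [/eqnP ji|_]; last by rewrite scale0r.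
    by move: sj; rewrite ji leqNgt ltn_ord.
  - by rewrite IH1 IH2 -big_split; apply: eq_bigr => i _; rewrite scalerDl.
  - by rewrite IH -sumrN; apply: eq_bigr => i _; rewrite scaleNr.
  - by rewrite IH scaler_sumr; apply: eq_bigr => i _; rewrite scalerA.
have coefP : forall t j, same_coefs t a b j ->
    forall i, (i < size t)%N -> lincoef a (j + i) = lincoef b (j + i).
  elim=> [//|v t IH] j /= [h ht] [_|i it]; first by rewrite addn0.
  by rewrite addnS -addSn; apply: IH.
move=> h; rewrite !evalE; apply: eq_bigr => i _.
by rewrite -[nat_of_ord i]add0n (coefP _ _ h).
Qed.

End LinearCombinations.

Ltac lin_index s v :=
  lazymatch s with
  | nil => constr:(0%N)
  | v :: _ => constr:(0%N)
  | _ :: ?s' => let i := lin_index s' v in constr:(S i)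
  end.

(* A term outside of s can only be 0: it gets the index [size s], at which
   [lineval] reads the default value of [nth]. *)
Ltac lin_reify R s t :=
  lazymatch t with
  | ?a + ?b => let a' := lin_reify R s a in let b' := lin_reify R s b in
               constr:(@LAdd R a' b')
  | - ?a => let a' := lin_reify R s a in constr:(@LOpp R a')
  | ?c *: ?a => let a' := lin_reify R s a in constr:(@LScale R c a')
  | ?v => let i := lin_index s v in constr:(@LVar R i)
  end.

(** Reduces an equation between linear combinations of the vectors of s, with
    coefficients in R, to the equality of their coefficients. *)
Ltac lin_eq R s :=
  lazymatch goal with
  | |- ?l = ?r =>
      let a := lin_reify R s l in let b := lin_reify R s r in
      change (lineval s a = lineval s b); apply: lineval_eq;
      cbn [same_coefs lincoef eqn]; repeat split
  end.

(** * Continuity and compactness in finite dimension *)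

Section FiniteDim.
Context {R : realType} {L : normedLieAlgType R}.
Local Notation b := (vbasis {:L}).
Local Notation n := (\dim {:L}).

Let b_basis : basis_of {:L} b := vbasisP fullv.

Lemma vecof_continuous : continuous (vecof b : 'rV[R]_n -> L).
Proof.
have cZ i : continuous (fun v : 'rV[R]_n => v 0 i *: (b`_i : L)).
  by move=> v; apply: (@continuousZr_tmp R L _ (fun v : 'rV[R]_n => v 0 i) _ v); exact: coord_continuous.
apply: (continuous_big (op := +%R)) => [|i _]; first exact: add_continuous.
exact: cZ.
Qed.

(** Comparison of the given norm with the one of coordinates: the unit sphere of
    the latter is compact, and the former does not vanish on it. *)
Lemma coord_bound : exists2 M : R, 0 < M &
  forall (i : 'I_n) (x : L), `|coord b i x| <= M * `|x|.
Proof.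
pose S := [set v : 'rV[R]_n | `|v| = 1].
have [S0|/set0P S0] := eqVneq S set0.
  exists 1 => // i x; have [->|x0] := eqVneq x 0.
    by rewrite linear0 !normr0 mulr0.
  have : S (`|rVof b x|^-1 *: rVof b x).
    by rewrite /S /= normrZ normfV normr_id mulVf// normr_eq0 rVof_eq0.
  by rewrite S0.
have cS : compact S.
  apply: bounded_closed_compact.
    exists 1; split; first exact: num_real.
    by move=> M M1 v /= ->; exact: ltW.
  apply: (@closed_comp _ _ (fun v : 'rV[R]_n => `|v|) [set x | x = 1]) => //.
    by move=> v _; exact: norm_continuous.
have [|v vS vmin] := compact_EVT_min (f := fun v : 'rV[R]_n => `|vecof b v|) S0 cS.
  apply: continuous_subspaceT => v.
  by apply: continuous_comp; [exact: vecof_continuous|exact: norm_continuous].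
have m0 : 0 < `|vecof b v|.
  rewrite normr_gt0 vecof_eq0// -normr_eq0.
  by move: vS; rewrite inE /S /= => ->; exact: oner_neq0.
exists (`|vecof b v|^-1); first by rewrite invr_gt0.
move=> i x; rewrite coord_rVof mulrC ler_pdivlMr//.
have [x0|x0] := eqVneq (rVof b x) 0.
  by rewrite x0 mxE normr0 mul0r.
apply: (@le_trans _ _ (`|rVof b x| * `|vecof b v|)).
  rewrite ler_wpM2r//.
  rewrite [leRHS]/Num.norm /= mx_normrE; apply/bigmax_geP; right => /=.
  by exists (0, i).
have := vmin (`|rVof b x|^-1 *: rVof b x).
rewrite inE /S /= normrZ normfV normr_id mulVf ?normr_eq0// => /(_ erefl).
rewrite linearZ/= rVofK// normrZ normfV normr_id.
by rewrite ler_pdivlMl ?normr_gt0// mulrC.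
Qed.

Lemma vbasis_coord_continuous (i : 'I_n) : continuous (coord b i : L -> R^o).
Proof.
apply/linear_bounded_continuous/bounded_funP => r.
have [M M0 Mb] := coord_bound.
exists (M * r) => x xr; apply: le_trans (Mb i x) _.
by rewrite ler_wpM2l// ltW.
Qed.

Lemma linear_continuous_findim (W : normedModType R) (f : {linear L -> W}) :
  continuous f.
Proof.
have -> : (f : L -> W) = fun x => \sum_i coord b i x *: f b`_i.
  apply/funext => x; rewrite [in LHS](coord_basis b_basis (memvf x)) linear_sum.
  by apply: eq_bigr => i _; rewrite linearZ.
have cZ i : continuous (fun x : L => coord b i x *: f b`_i).
  by move=> v; apply: cvgZr_tmp; exact: vbasis_coord_continuous.
apply: (continuous_big (op := +%R)) => [|i _]; first exact: add_continuous.
exact: cZ.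
Qed.

Lemma coord_box_compact (M : R) :
  compact [set x : L | forall i, `|coord b i x| <= M].
Proof.
have -> : [set x : L | forall i, `|coord b i x| <= M] =
   vecof b @` [set v : 'rV[R]_n | forall i, v ord0 i \in `[- M, M]].
  apply/seteqP; split => [x xM|_ [v vM <-]] /=.
    exists (rVof b x); last by rewrite rVofK.
    by move=> i /=; rewrite -coord_rVof in_itv/= -ler_norml.
  by move=> i; rewrite coord_rVof vecofK// ler_norml; have := vM i; rewrite in_itv.
apply: continuous_compact.
  by apply: continuous_subspaceT; exact: vecof_continuous.
apply: (@rV_compact _  _ (fun=> `[(- M), M]%classic)).
by move=> _; apply: segment_compact.
Qed.

End FiniteDim.

(** * Convex sets and the faces generated by their points *)

Section Convexity.
Context {R : realType} {L : lmodType R}.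
Implicit Types (x y z v w : L) (C F : set L).

Lemma convex_setE C :
  convex_set (C : set (convex_lmodType L)) <->
  forall x y (t : R), C x -> C y -> 0 <= t <= 1 -> C ((1 - t) *: x + t *: y).
Proof.
split=> [cC x y t Cx Cy /andP[t0 t1]|cC x y l].
  have := cC y x (Itv01 t0 t1); rewrite !inE => /(_ Cy Cx).
  by rewrite addrC.
rewrite !inE => Cx Cy; have := cC y x l%:num Cy Cx.
by rewrite addrC; apply; rewrite ge0 le1.
Qed.

Lemma convex_shrink C x v (s : R) :
  convex_set (C : set (convex_lmodType L)) -> C x -> C (x + v) -> 0 <= s <= 1 -> C (x + s *: v).
Proof.
move=> /convex_setE cC Cx Cxv s01.
have := cC x (x + v) s Cx Cxv s01.
by rewrite scalerDr addrA -scalerDl subrK scale1r.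
Qed.

(** The factor 2 ^+ size s makes the induction go by midpoints: for s = j :: s' the
    conclusion is about the midpoint of x + 2 (w j) and of the point that the
    doubled displacements indexed by s' reach from x. *)
Lemma convex_sum_shrink C x (I : Type) (s : seq I) (w : I -> L) :
  convex_set (C : set (convex_lmodType L)) -> C x ->
  (forall i, C (x + 2 ^+ size s *: w i)) -> C (x + \sum_(i <- s) w i).
Proof.
move=> cC Cx; elim: s w => [|j s IH] w Cw; first by rewrite big_nil addr0.
have /convex_setE cC' := cC.
have := cC' (x + 2 *: w j) (x + \sum_(i <- s) 2 *: w i) 2^-1.
rewrite -scaler_sumr big_cons.
have -> : (1 - 2^-1) *: (x + 2 *: w j) + 2^-1 *: (x + 2 *: (\sum_(j <- s) w j)) =
   x + (w j + \sum_(i <- s) w i).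
  by set S := \sum_(_ <- _) _; lin_eq R [:: x; w j; S]; field.
apply; last by apply/andP; split; lra.
  have -> : 2 *: w j = (2 ^+ size s)^-1 *: (2 ^+ size (j :: s) *: w j).
    by rewrite scalerA /= exprS mulrCA mulVf ?mulr1// expf_neq0.
  apply: convex_shrink => //.
  rewrite invr_ge0 exprn_ge0//= invf_le1 ?exprn_gt0//.
  by rewrite exprn_ege1// ler1n.
rewrite scaler_sumr; apply: IH => i; rewrite scalerA -exprSr; exact: Cw.
Qed.

(** When x is in the convex set C this is the smallest face of C that contains x:
    it collects the points y such that the segment from y to x can be prolonged
    inside C beyond x. *)
Definition face_of C x : set L :=
  [set y | C y /\ exists2 e : R, 0 < e & C (x - e *: (y - x))].

(** x lies in the relative interior of the segment from y to x - e (y - x), at the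
    parameter 1 / (1 + e). *)
Lemma relint_face C F x y (e : R) :
  face C F -> F x -> C y -> 0 < e -> C (x - e *: (y - x)) -> F y.
Proof.
case=> _ _ _ hF Fx Cy e0 Cz; apply: (hF _ _ Cy Cz); last first.
  by exists 0; [rewrite /= lexx ler01|rewrite subr0 scale1r scale0r addr0].
exists x; split => //; have e1 : 0 < 1 + e by rewrite addr_gt0.
exists (1 + e)^-1.
  by rewrite /= invr_gt0 e1 invf_lt1// ltrDl.
by lin_eq R [:: x; y]; field; exact: lt0r_neq0.
Qed.

Lemma face_of_face C x :
  convex_set (C : set (convex_lmodType L)) -> C x -> face C (face_of C x).
Proof.
move=> cC Cx; have /convex_setE cC' := cC.
have cF : convex_set (face_of C x : set (convex_lmodType L)).
  apply/convex_setE => y z t [Cy [e e0 Ce]] [Cz [d d0 Cd]] t01.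
  split; first exact: cC'.
  pose m := Num.min e d; have m0 : 0 < m by rewrite lt_min e0.
  exists m => //.
  have sm (f : R) u : 0 < f -> m <= f -> C (x - f *: (u - x)) -> C (x - m *: (u - x)).
    move=> f0 mf h; have -> : - (m *: (u - x)) = (m / f) *: - (f *: (u - x)).
      by rewrite scalerN scalerA divfK// gt_eqF.
    apply: convex_shrink => //.
    by rewrite divr_ge0 ?(ltW m0) ?(ltW f0)//= ler_pdivrMr// mul1r.
  have me : m <= e by rewrite /m ge_min lexx.
  have md : m <= d by rewrite /m ge_min lexx orbT.
  have := cC' _ _ t (sm e y e0 me Ce) (sm d z d0 md Cd) t01; congr C.
  by lin_eq R [:: x; y; z]; ring.
have fy y z w t : C y -> C z -> face_of C x w -> 0 < t < 1 ->
    w = (1 - t) *: y + t *: z -> face_of C x y.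
  move=> Cy Cz [_ [e e0 Ce]] /andP[t0 t1] wE; split => //.
  have et : 0 < 1 + e * t by rewrite addr_gt0 ?mulr_gt0.
  (* the combination of x - e (w - x) and z with weights a and 1 - a, where a is
     chosen to cancel z *)
  pose a := (1 + e * t)^-1.
  have a0 : 0 < a by rewrite invr_gt0.
  exists (a * e * (1 - t)); first by rewrite !mulr_gt0 ?subr_gt0.
  have := cC' _ _ (1 - a) Ce Cz; rewrite subr_ge0 gerBl (ltW a0) invf_le1//.
  rewrite lerDl mulr_ge0 ?(ltW e0) ?(ltW t0)// => /(_ isT); congr C.
  by rewrite wE; lin_eq R [:: x; y; z]; rewrite /a; field; exact: lt0r_neq0.
split=> //; first by exists x; split => //; exists 1 => //; rewrite subrr scaler0 subr0.
  by move=> y [].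
move=> y z Cy Cz [w [[t t01 wE] Fw]].
have Fy : face_of C x y by apply: (fy y z w t).
have Fz : face_of C x z.
  apply: (fy z y w (1 - t)) => //.
    by case/andP: t01 => t0 t1; rewrite subr_gt0 t1/= ltrBlDr ltrDl.
  by rewrite -wE opprB addrCA subrr addr0 addrC.
by move=> _ [s s01 <-]; move/convex_setE: cF; apply.
Qed.

(** The segment from any y in C to such a point x can be prolonged inside C beyond x
    by the proportion d of its length.  Having one d for all y makes this set
    compact when C is. *)
Definition relint_points (d : R) C : set L :=
  [set x | C x /\ forall y, C y -> C (x - d *: (y - x))].

Lemma face_relint_points C F x (d : R) :
  face C F -> 0 < d -> relint_points d F x -> F = face_of C x.
Proof.
move=> fF d0 [Fx hd]; have [_ FC _ _] := fF.
apply/seteqP; split=> [y Fy|y [Cy [e e0 Ce]]].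
  by split; [exact: FC|exists d => //; exact/FC/hd].
exact: relint_face e0 Ce.
Qed.

End Convexity.

(** * Existence of relative interior points *)

Section RelativeInterior.
Context {R : realType} {L : normedLieAlgType R}.
Implicit Types (x y z v w : L) (C F : set L).

(** A largest free family of directions along which C extends on both sides of
    one of its points spans the directions from that point to all of C: any
    further direction y - x could be added after moving x to the midpoint of x
    and y. *)
Lemma convex_span_directions C : C !=set0 -> convex_set (C : set (convex_lmodType L)) ->
  exists x (us : seq L), [/\ C x,
    exists2 e : R, 0 < e & forall u, u \in us -> C (x + e *: u) /\ C (x - e *: u),
    free us & forall y, C y -> y - x \in <<us>>%VS].
Proof.
move=> [x0 Cx0] cC; have /convex_setE cC' := cC.
pose Q n := exists x (us : seq L), [/\ C x, size us = n, free us &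
  exists e : R, [/\ 0 < e, e <= 1 & forall u, u \in us -> C (x + e *: u) /\ C (x - e *: u)]].
have Q0 : exists n, `[< Q n >].
  exists 0%N; apply/asboolP; exists x0, [::]; split=> //; first exact: nil_free.
  by exists 1; split.
have Qb n : `[< Q n >] -> (n <= \dim {:L})%N.
  move=> /asboolP[x [us [_ <- /eqP <- _]]]; exact/dimvS/subvf.
have [n /asboolP[x [us [Cx sz fus [e [e0 e1 he]]]]] nmax] := ex_maxnP Q0 Qb.
exists x, us; split => //; first by exists e.
move=> y Cy; apply: contrapT => /negP yx.
suff /asboolP/nmax : Q n.+1 by rewrite ltnn.
exists (2^-1 *: (x + y)), (y - x :: us); split.
- have := cC' _ _ 2^-1 Cx Cy; rewrite invr_ge0 ler0n invf_le1// ler1n => /(_ isT).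
  by congr C; lin_eq R [:: x; y]; field.
- by rewrite /= sz.
- by rewrite free_cons yx.
exists (e / 2); split; [by rewrite divr_gt0|by rewrite ler_pdivrMr//; lra|].
move=> u; rewrite in_cons => /predU1P[->|/he[Cp Cm]]; split.
- have := cC' _ _ (2^-1 + e / 2) Cx Cy.
  have -> : 0 <= 2^-1 + e / 2 <= 1 by lra.
  by move=> /(_ isT); congr C; lin_eq R [:: x; y]; field.
- have := cC' _ _ (2^-1 - e / 2) Cx Cy.
  have -> : 0 <= 2^-1 - e / 2 <= 1 by lra.
  by move=> /(_ isT); congr C; lin_eq R [:: x; y]; field.
- have := cC' _ _ 2^-1 Cp Cy; rewrite invr_ge0 ler0n invf_le1// ler1n => /(_ isT).
  by congr C; lin_eq R [:: x; y; u]; field.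
- have := cC' _ _ 2^-1 Cm Cy; rewrite invr_ge0 ler0n invf_le1// ler1n => /(_ isT).
  by congr C; lin_eq R [:: x; y; u]; field.
Qed.

(** In the coordinates given by the directions of [convex_span_directions] the set
    C is bounded, and around the point found there it contains a cross-polytope;
    the quotient of the two sizes is a possible d. *)
Lemma exists_relint C (B : set L) : C !=set0 ->
  convex_set (C : set (convex_lmodType L)) -> C `<=` B -> compact B ->
  exists2 d : R, 0 < d & relint_points d C !=set0.
Proof.
move=> C0 cC CB cB.
have [x [us [Cx [e e0 he] fus xus]]] := convex_span_directions C0 cC.
pose n := size us.
pose t := in_tuple us.
pose row (v : L) : 'rV[R]_n := \row_i coord t i v.
have row_lin : linear row.
  by move=> c u v; apply/rowP => i; rewrite !mxE linearP.
pose rowL : {linear L -> 'rV[R]_n} := HB.pack row (GRing.isLinear.Build R L _ _ row row_lin).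
have [M0 [M0r BM]] := compact_bounded cB.
have M01 : M0 < M0 + 1 by rewrite ltrDl.
have := @linear_continuous_findim _ _ _ rowL.
move/linear_bounded_continuous/bounded_funP => /(_ ((M0 + 1) + (M0 + 1))) [M rowM].
have cM i y : C y -> `|coord t i (y - x)| <= M.
  move=> Cy; apply: (@le_trans _ _ `|row (y - x)|).
    rewrite [leRHS]/Num.norm /= mx_normrE; apply/bigmax_geP; right => /=.
    by exists (0, i) => //; rewrite mxE.
  apply: rowM; apply: le_trans (ler_normB _ _) _.
  by apply: lerD; apply: BM M01 _ _; exact: CB.
pose M' := `|M| + 1; have M'0 : 0 < M' by rewrite ltr_wpDl.
pose d := e / (2 ^+ n * M').
have d0 : 0 < d by rewrite divr_gt0// mulr_gt0// exprn_gt0.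
exists d => //; exists x; split=> // y Cy.
have -> : x - d *: (y - x) = x + \sum_(i <- enum 'I_n) (- (d * coord t i (y - x))) *: t`_i.
  rewrite -[in LHS]scaleNr; congr (_ + _).
  rewrite big_enum/= {1}(coord_span (X := t) (v := y - x))// ?xus//.
  by rewrite scaler_sumr; apply: eq_bigr => i _; rewrite scalerA mulNr.
apply: convex_sum_shrink => // i; rewrite size_enum_ord scalerA.
have [Cp Cm] : C (x + e *: t`_i) /\ C (x - e *: t`_i) by apply: he; exact: mem_nth.
set c := coord _ _ _.
have cle : `|c| / M' <= 1.
  rewrite ler_pdivrMr// mul1r; apply: le_trans (cM i y Cy) _.
  by rewrite (le_trans (ler_norm _))// lerDl.
have -> : (2 ^+ n * - (d * c)) = - (c / M') * e.
  by rewrite /d; field; rewrite gt_eqF//= expf_neq0.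
have [c0|c0] := leP 0 c.
  rewrite mulNr scaleNr -scalerA -scalerN.
  apply: convex_shrink => //; rewrite divr_ge0 ?(ltW M'0)//=.
  by move: cle; rewrite ger0_norm.
rewrite -mulNr -scalerA; apply: convex_shrink => //.
by move: cle; rewrite ltr0_norm// => ->; rewrite andbT divr_ge0 ?(ltW M'0)// oppr_ge0 ltW.
Qed.

End RelativeInterior.

(** * The Killing form *)

Section Killing.
Context {R : realFieldType} {L : lieAlgType R}.
Implicit Types x y z : L.
Local Notation b := (vbasis {:L}).

Let b_basis : basis_of {:L} b := vbasisP fullv.

HB.instance Definition _ x :=
  GRing.isLinear.Build R L L _ (lie x) (lie_linearr x).

Lemma lieC x y : lie x y = - lie y x.
Proof.
have lD : forall z : L, {morph (lie^~ z) : u v / u + v >-> u + v}.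
  by move=> z u v; have := lie_linearl z 1 u v; rewrite /= !scale1r.
have := liexx (x + y).
rewrite linearD/= !lD !liexx add0r addr0 addrC => /eqP.
by rewrite addr_eq0 => /eqP.
Qed.

Lemma lieDl x y z : lie (x + y) z = lie x z + lie y z.
Proof. by rewrite lieC linearD/= opprD -!lieC. Qed.

Lemma lieZl c x z : lie (c *: x) z = c *: lie x z.
Proof. by rewrite lieC linearZ/= -scalerN -lieC. Qed.

Lemma lieNl x z : lie (- x) z = - lie x z.
Proof. by rewrite lieC linearN/= opprK lieC. Qed.

Lemma jacobi x y z : lie x (lie y z) = lie (lie x y) z + lie y (lie x z).
Proof.
have /eqP := lie_jacobi x y z.
rewrite (lieC z x) linearN/= -addrA addr_eq0 => /eqP ->.
by rewrite opprD opprK addrC -lieC.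
Qed.

Definition ad x : 'End(L) := linfun (lie x).

Lemma adE x y : ad x y = lie x y.
Proof. by rewrite lfunE. Qed.

Local Notation mx := (mxof b b).

Lemma killingE x y : killing x y = \tr (mx (ad y) *m mx (ad x)).
Proof.
rewrite /killing -(mxof_comp b b b_basis); congr (\tr (mx _)).
apply/lfunP => z; rewrite comp_lfunE !lfunE /=.
by rewrite (lfunE [the {linear L -> L} of lie x \o lie y]).
Qed.

Lemma killingC x y : killing x y = killing y x.
Proof. by rewrite !killingE mxtrace_mulC. Qed.

Lemma ad_linear : linear ad.
Proof.
by move=> c x y; apply/lfunP => z; rewrite add_lfunE scale_lfunE !adE lieDl lieZl.
Qed.

HB.instance Definition _ := GRing.isLinear.Build R L 'End(L) _ ad ad_linear.

Lemma killing_linearr x : linear (killing x : L -> R^o).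
Proof.
by move=> c y z; rewrite !killingE linearP/= linearP/= mulmxDl -scalemxAl linearP.
Qed.

HB.instance Definition _ x :=
  GRing.isLinear.Build R L R^o _ (killing x : L -> R^o) (killing_linearr x).

Lemma killingDl x y z : killing (x + y) z = killing x z + killing y z.
Proof. by rewrite killingC linearD/= !(killingC z). Qed.

Lemma killingZl c x z : killing (c *: x) z = c * killing x z.
Proof. by rewrite killingC linearZ/= !(killingC z). Qed.

Lemma killingNl x z : killing (- x) z = - killing x z.
Proof. by rewrite killingC linearN/= !(killingC z). Qed.

Lemma killing_lie x y z : killing (lie x y) z = killing x (lie y z).
Proof.
have adlie u v : ad (lie u v) = (ad u \o ad v)%VF - (ad v \o ad u)%VF.
  apply/lfunP => w; rewrite !(add_lfunE, opp_lfunE, comp_lfunE, adE).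
  by rewrite (jacobi u v w) addrK.
rewrite !killingE !adlie !linearB/= !(mxof_comp b b b_basis).
rewrite mulmxBl !linearB/= !mulmxA.
by congr (_ - _); rewrite mxtrace_mulC mulmxA.
Qed.

End Killing.

(** * The inner product of a Cartan involution *)

(** This form is positive definite for a Cartan involution theta, and it agrees
    with the Killing form on the eigenspace p. *)
Definition cform {R : realFieldType} {L : lieAlgType R} (theta : 'End(L)) (x y : L) : R :=
  - killing x (theta y).

Section CartanAlg.
Context {R : realFieldType} {L : lieAlgType R} (theta : 'End(L)).
Hypothesis thetaP : cartan_involution theta.
Implicit Types x y z : L.
Local Notation ip := (cform theta).
Local Notation k := (cartan_k theta).
Local Notation p := (cartan_p theta).

Let thetaK x : theta (theta x) = x. Proof. by case: thetaP. Qed.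

(** theta is an automorphism, so it conjugates the matrices of ad x and ad y. *)
Lemma killing_theta x y : killing (theta x) (theta y) = killing x y.
Proof.
pose b := vbasis {:L}; have b_basis : basis_of {:L} b := vbasisP fullv.
have adth u : ad (theta u) = (theta \o ad u \o theta)%VF.
  apply/lfunP => w; rewrite !comp_lfunE !adE.
  by case: thetaP => _ -> _; rewrite thetaK.
have thth : mxof b b theta *m mxof b b theta = 1%:M.
  rewrite -(mxof_comp b b b_basis) -(mxof1 (basis_free b_basis)); congr mxof.
  by apply/lfunP => w; rewrite !lfunE/= thetaK.
rewrite !killingE !adth !(mxof_comp b b b_basis) !mulmxA.
by rewrite mxtrace_mulC !mulmxA thth mul1mx -!mulmxA (mulmxA (mxof _ _ theta)) thth mul1mx.
Qed.

Lemma cform_linear x : linear (ip x : L -> R^o).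
Proof.
move=> c y z; rewrite /cform [theta _]linearP [killing _ _]linearP /=.
by rewrite opprD scalerN.
Qed.

HB.instance Definition _ x :=
  GRing.isLinear.Build R L R^o _ (ip x : L -> R^o) (cform_linear x).

Lemma cformC x y : ip x y = ip y x.
Proof. by rewrite /cform -killing_theta thetaK killingC. Qed.

Lemma cformDr x y z : ip x (y + z) = ip x y + ip x z.
Proof. by rewrite linearD. Qed.
Lemma cformZr c x z : ip x (c *: z) = c * ip x z.
Proof. by rewrite linearZ. Qed.
Lemma cformBr x y z : ip x (y - z) = ip x y - ip x z.
Proof. by rewrite linearB. Qed.
Lemma cformDl x y z : ip (x + y) z = ip x z + ip y z.
Proof. by rewrite !(cformC _ z) cformDr. Qed.
Lemma cformZl c x z : ip (c *: x) z = c * ip x z.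
Proof. by rewrite !(cformC _ z) cformZr. Qed.
Lemma cformBl x y z : ip (x - y) z = ip x z - ip y z.
Proof. by rewrite !(cformC _ z) cformBr. Qed.

Lemma cform_ge0 x : 0 <= ip x x.
Proof.
have [->|x0] := eqVneq x 0; first by rewrite linear0.
by apply: ltW; case: thetaP => _ _; apply.
Qed.

Lemma cform_eq0 x : ip x x = 0 -> x = 0.
Proof.
move=> x0; apply/eqP; apply: contraT => /[dup] xn0.
by case: thetaP => _ _ /[apply]; rewrite -/(ip x x) x0 ltxx.
Qed.

Lemma cform_inj x y : (forall z, ip x z = ip y z) -> x = y.
Proof.
by move=> xy; apply/eqP; rewrite -subr_eq0; apply/eqP/cform_eq0; rewrite cformBl xy subrr.
Qed.

Lemma cform_p x y : p y -> ip x y = killing x y.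
Proof. by rewrite /cform => ->; rewrite linearN/= opprK. Qed.

Lemma cform_lie X x y : k X -> ip (lie X x) y = - ip x (lie X y).
Proof.
move=> kX; rewrite /cform lieC killingNl killing_lie.
by case: thetaP => _ -> _; rewrite kX.
Qed.

Lemma adjoint_linear (T T' : L -> L) :
  (forall x y, ip (T x) y = ip x (T' y)) -> linear T.
Proof.
move=> adj c x y; apply: cform_inj => z.
by rewrite adj cformDl cformZl cformDl cformZl !adj.
Qed.

Lemma isometry_adjointK (T T' : L -> L) : (forall x y, ip (T x) y = ip x (T' y)) ->
  (forall x, ip (T x) (T x) = ip x x) -> cancel T T'.
Proof.
move=> adj iso x; apply: cform_inj => y.
have TD : T (x + y) = T x + T y.
  by have := adjoint_linear adj 1 x y; rewrite !scale1r.
have := iso (x + y); rewrite TD !(cformDl, cformDr) !iso.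
rewrite (cformC y x) (cformC (T y)) (cformC (T' _)) -adj.
rewrite (cformC (T y)); lra.
Qed.

Lemma cauchy_schwarz x y : (ip x y) ^+ 2 <= ip x x * ip y y.
Proof.
have [->|y0] := eqVneq y 0.
  by rewrite !linear0 expr0n/= mulr0.
have yy : 0 < ip y y.
  by rewrite lt_neqAle cform_ge0 andbT eq_sym; apply: contra y0 => /eqP/cform_eq0 ->.
have := cform_ge0 (ip y y *: x - ip x y *: y).
rewrite !(cformBl, cformBr, cformZl, cformZr) (cformC y x) => h.
have {}h : 0 <= ip y y * (ip x x * ip y y - ip x y ^+ 2).
  by apply: le_trans h _; rewrite le_eqVlt; apply/orP; left; apply/eqP; ring.
by move: h; rewrite pmulr_rge0// subr_ge0.
Qed.

(** The map that sends beta to its products with a basis of U is injective on U,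
    hence onto for dimension reasons. *)
Lemma riesz (U : {vspace L}) (f : {linear L -> R^o}) :
  exists2 beta, beta \in U & forall y, y \in U -> f y = ip y beta.
Proof.
pose phi (beta : L) := \row_(i < \dim U) (ip (vbasis U)`_i beta).
have phi_lin : linear phi.
  by move=> c x y; apply/rowP => i; rewrite !mxE cformDr cformZr.
pose phiL := GRing.isLinear.Build R L _ _ phi phi_lin.
pose phi' : {linear L -> 'rV[R]_(\dim U)} := HB.pack phi phiL.
pose F := linfun phi'.
have sumE y beta : y \in U ->
    ip y beta = \sum_(i < \dim U) coord (vbasis U) i y * ip (vbasis U)`_i beta.
  move=> yU; rewrite cformC {1}(coord_vbasis yU) linear_sum/=.
  by apply: eq_bigr => i _; rewrite linearZ/= cformC.
have : (F @: U)%VS = fullv.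
  apply/eqP; rewrite eqEdim subvf dimvf /dim/= mul1n limg_dim_eq//.
  apply/eqP; rewrite -subv0; apply/subvP => x; rewrite memv_cap memv_ker memv0 lfunE /=.
  case/andP => xU /eqP/rowP x0; apply/eqP/cform_eq0.
  rewrite (sumE _ _ xU) big1// => i _.
  by have := x0 i; rewrite !mxE => ->; rewrite mulr0.
move=> imF; have : \row_i (f (vbasis U)`_i) \in (F @: U)%VS by rewrite imF memvf.
case/memv_imgP => beta bU; rewrite lfunE/= => /rowP h; exists beta => // y yU.
rewrite (sumE _ _ yU) (coord_vbasis yU) linear_sum/=.
apply: eq_bigr => i _; rewrite linearZ/= -coord_vbasis//.
by have := h i; rewrite !mxE => ->.
Qed.

Lemma lie_pp x y : p x -> p y -> k (lie x y).
Proof.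
rewrite /cartan_k /cartan_p /= => px py.
by case: thetaP => _ -> _; rewrite px py lieNl linearN/= opprK.
Qed.

Lemma killing_k_eq0 X : k X -> killing X X = 0 -> X = 0.
Proof. by move=> kX X0; apply: cform_eq0; rewrite /cform kX X0 oppr0. Qed.

Definition p_part (x : L) : L := 2^-1 *: (x - theta x).

Lemma p_partP x : p (p_part x).
Proof.
by rewrite /cartan_p /p_part/= linearZ/= linearB/= thetaK -scalerN opprB.
Qed.

Lemma cform_p_part x y : p x -> ip x (p_part y) = ip x y.
Proof.
move=> px; rewrite /p_part cformZr cformBr.
have -> : ip x (theta y) = - ip x y.
  by rewrite /cform thetaK -{1}[x]opprK -px killingNl -[y in killing _ y]thetaK killing_theta.
by rewrite opprK; field.
Qed.

End CartanAlg.

(** * Linear sections of a body *)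

Section LinearSection.
Context {R : realType} {L : normedLieAlgType R} (theta : 'End(L)).
Hypothesis thetaP : cartan_involution theta.
Implicit Types (x y z : L) (C F E : set L).
Local Notation p := (cartan_p theta).

(** Let x be a relative interior point of a face F of the section.  The face
    of the whole body generated by x cuts a exactly in F, and the orthogonal
    projection to a of a vector that exposes it exposes F. *)
Lemma exposed_section E (a : {vspace L}) : convex_body E -> [set` a] `<=` p ->
  all_faces_exposed killing p E ->
  all_faces_exposed killing [set` a] (E `&` [set` a]).
Proof.
move=> [_ cE convE] ap exE F fF.
have [F0 FP cF _] := fF.
have FE : F `<=` E by move=> x /FP[].
have [d d0 [x Fdx]] := exists_relint F0 cF FE cE.
have [Fx _] := Fdx; have Ffx := face_relint_points fF d0 Fdx.
have [beta _ hbeta] := exE _ (face_of_face convE (FE _ Fx)).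
have [b ba hb] := riesz thetaP a (killing beta).
have {}hb y : y \in a -> killing y b = killing y beta.
  move=> ya; rewrite [RHS]killingC hb// (cform_p _ (ap _ ba))//.
have xa : x \in a by have [] := FP _ Fx.
have fax : face_of (E `&` [set` a]) x = face_of E x `&` [set` a].
  apply/seteqP; split=> [y [[Ey ya] [e e0 [Ee _]]]|y [[Ey [e e0 Ee]] ya]].
    by split=> //; split=> //; exists e.
  split=> //; exists e => //; split=> //=.
  by rewrite memvB// memvZ// memvB.
have Ex : face_of E x x by split; [exact: FE|exists 1; rewrite // subrr scaler0 subr0; exact: FE].
exists b => //; rewrite Ffx fax hbeta.
have hx : forall y, E y -> killing y beta <= killing x beta by move: Ex; rewrite hbeta => -[].
apply/seteqP; split=> [y [[Ey hy] ya]|y [[Ey ya] hy]].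
  by split=> // z [Ez za]; rewrite !hb//; exact: hy.
split=> //; split=> // z Ez; apply: le_trans (hx _ Ez) _.
by rewrite -!hb//; apply: hy; split=> //; exact: FE.
Qed.

End LinearSection.

(** * Flows of ad X *)

Section Derivatives.
Context {R : realType}.

Lemma is_derive_linear (V W : normedModType R) (f : {linear V -> W})
    (c : R^o -> V) (t v : R^o) (c' : V) :
  continuous f -> is_derive t v c c' -> is_derive t v (f \o c) (f c').
Proof.
move=> cf [dc <-].
have cv : (fun h : R^o => h^-1 *: (((f \o c) \o shift t) (h *: v) - (f \o c) t)) @ 0^'
    --> f ('D_v c t).
  rewrite [X in X @ _](_ : _ = f \o (fun h : R^o => h^-1 *: ((c \o shift t) (h *: v) - c t))).
    by apply: continuous_cvg; [exact: cf|exact: dc].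
  by apply/funext => h; rewrite [RHS]linearZ [X in _ = _ X]linearB.
by split; [apply/cvg_ex; eexists; exact: cv|apply: cvg_lim cv].
Qed.

Lemma is_derive_comp_shift (V W : normedModType R) (f : V -> W) (u v t : V) w :
  is_derive (u + t) v f w -> is_derive u v (fun s => f (s + t)) w.
Proof.
have E : (fun h : R => h^-1 *: (((fun s => f (s + t)) \o shift u) (h *: v) - f (u + t)))
    = fun h : R => h^-1 *: ((f \o shift (u + t)) (h *: v) - f (u + t)).
  by apply/funext => h /=; rewrite addrA.
by case=> dv <-; split; rewrite /derivable /derive/= E.
Qed.

End Derivatives.

Section Flow.
Context {R : realType} {L : normedLieAlgType R} (theta : 'End(L)).
Hypothesis thetaP : cartan_involution theta.
Implicit Types x y z : L.
Local Notation ip := (cform theta).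
Local Notation k := (cartan_k theta).

(** Reduces the continuity and the differentiability of the form to those of
    products of real functions. *)
Lemma cform_coord x y :
  ip x y = \sum_i coord (vbasis {:L}) i y * ip (vbasis {:L})`_i x.
Proof.
rewrite [y in LHS](coord_basis (vbasisP fullv) (memvf y)) linear_sum/=.
by apply: eq_bigr => i _; rewrite linearZ/= cformC.
Qed.

Lemma cvg_cform (T : Type) (F : set_system T) (f g : T -> L) (x y : L) : Filter F ->
  f @ F --> x -> g @ F --> y -> (fun t => ip (f t) (g t) : R^o) @ F --> (ip x y : R^o).
Proof.
move=> FF fx gy; rewrite cform_coord.
under eq_fun do rewrite cform_coord.
apply: (cvg_big (op := +%R)) => [|i _]; first exact: add_continuous.
apply: (@cvgM R^o).
  by apply: continuous_cvg gy; exact: vbasis_coord_continuous.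
apply: continuous_cvg fx; exact: (@linear_continuous_findim _ _ _ (cform theta (vbasis {:L})`_i)).
Qed.

Lemma is_derive_cform (c d : R^o -> L) (t : R^o) (c' d' : L) :
  is_derive t 1 c c' -> is_derive t 1 d d' ->
  is_derive t 1 (fun s => ip (c s) (d s) : R^o) (ip c' (d t) + ip (c t) d').
Proof.
move=> hc hd.
pose b := vbasis {:L}.
have -> : (fun s => ip (c s) (d s) : R^o) =
    \sum_i (fun s => coord b i (d s) : R^o) * (fun s => ip b`_i (c s)).
  by apply/funext => s; rewrite cform_coord fct_sumE.
have H i : is_derive t 1 ((fun s => coord b i (d s) : R^o) * (fun s => ip b`_i (c s)))
    (coord b i (d t) *: ip b`_i c' + ip b`_i (c t) *: coord b i d').
  apply: is_deriveM.
    exact: (is_derive_linear (@vbasis_coord_continuous _ _ i) hd).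
  exact: (is_derive_linear (@linear_continuous_findim _ _ _ (cform theta b`_i)) hc).
apply: is_derive_eq.
rewrite big_split/= -!cform_coord; congr (_ + _).
by rewrite cform_coord; apply: eq_bigr => i _; rewrite mulrC.
Qed.

(** phi t is exp (t ad X). *)
Definition is_flow (X : L) (phi : R -> L -> L) :=
  (forall y, phi 0 y = y) /\
  forall (t : R^o) y, is_derive t 1 (fun s : R^o => phi s y) (lie X (phi t y)).

(** T is a linear isometry with inverse T'.  Stated through the adjoint, this
    passes to pointwise limits. *)
Definition isometry_pair (T T' : L -> L) :=
  [/\ forall x y, ip (T x) y = ip x (T' y), cancel T T' & cancel T' T].

(** For X in k the endomorphism ad X is skew-symmetric, so the product of two
    solutions of c' = [X, c] is constant. *)
Lemma lie_solutions_isometric X (c d : R^o -> L) t : k X ->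
  (forall t : R^o, is_derive t 1 c (lie X (c t))) ->
  (forall t : R^o, is_derive t 1 d (lie X (d t))) ->
  ip (c t) (d t) = ip (c 0) (d 0).
Proof.
move=> kX hc hd.
apply: (@is_derive_0_is_cst _ (fun s => ip (c s) (d s))) => s.
apply: is_derive_eq (is_derive_cform (hc s) (hd s)) _.
by rewrite cform_lie// addNr.
Qed.

Lemma lie_solutions_unique X (c d : R^o -> L) t : k X ->
  (forall t : R^o, is_derive t 1 c (lie X (c t))) ->
  (forall t : R^o, is_derive t 1 d (lie X (d t))) ->
  c 0 = d 0 -> c t = d t.
Proof.
move=> kX hc hd cd0; apply/eqP; rewrite -subr_eq0; apply/eqP/(cform_eq0 thetaP).
have h (s : R^o) : is_derive s 1 (c - d) (lie X ((c - d) s)).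
  by rewrite [X in lie _ X]/= linearB/=; apply: is_deriveB.
by have := lie_solutions_isometric t kX h h; rewrite !fctE cd0 subrr linear0.
Qed.

Section OneFlow.
Variables (X : L) (phi : R -> L -> L).
Hypotheses (kX : k X) (phiP : is_flow X phi).

Lemma flow0 y : phi 0 y = y. Proof. by case: phiP. Qed.

Lemma flow_add s t y : phi (s + t) y = phi s (phi t y).
Proof.
apply: (@lie_solutions_unique X (fun s => phi (s + t) y) (fun s => phi s (phi t y))) => //.
- by case: phiP => _ h u; apply: (is_derive_comp_shift (h _ y)).
- by case: phiP => _ h u; exact: h.
- by rewrite add0r flow0.
Qed.

Lemma flow_pair t : isometry_pair (phi t) (phi (- t)).
Proof.
have can s : cancel (phi s) (phi (- s)).
  by move=> y; rewrite -flow_add addNr flow0.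
split=> [x y||]; [|exact: can|by move=> y; have := can (- t) y; rewrite opprK].
rewrite -[y in LHS](can (- t) y) opprK.
have [_ h] := phiP.
rewrite (@lie_solutions_isometric X (phi^~ x) (phi^~ (phi (- t) y)))//= !flow0//.
Qed.

End OneFlow.

End Flow.

(** * Maximizers and maximal abelian subspaces *)

Definition maximizers {R : realFieldType} {L : lieAlgType R} (C : set L) (b : L) : set L :=
  [set x | C x /\ forall y, C y -> killing y b <= killing x b].

Section Core.
Context {R : realType} {L : normedLieAlgType R} (theta : 'End(L)).
Hypothesis thetaP : cartan_involution theta.
Implicit Types (x y z b X : L) (C S : set L).
Local Notation k := (cartan_k theta).
Local Notation p := (cartan_p theta).

Definition centralizes X S := forall s, S s -> lie X s = 0.

Definition flow_stable S C := forall X phi, k X -> centralizes X S ->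
  is_flow X phi -> forall t x, C x -> C (phi t x).

Hypothesis flow_exists : forall X, k X -> exists phi, is_flow X phi.

Lemma killing_continuous b : continuous (fun x : L => killing x b : R^o).
Proof.
have -> : (fun x : L => killing x b : R^o) = killing b.
  by apply/funext => x; rewrite killingC.
exact: linear_continuous_findim.
Qed.

Lemma maximizers_nonempty C b : C !=set0 -> compact C -> maximizers C b !=set0.
Proof.
move=> C0 cC; have [|c] := compact_EVT_max (f := fun x => killing x b) C0 cC.
  by apply: continuous_subspaceT; exact: killing_continuous.
rewrite inE => Cc hc; exists c; split=> // y Cy; apply: hc; exact/mem_set.
Qed.

Lemma maximizers_compact C b : C !=set0 -> compact C -> compact (maximizers C b).
Proof.
move=> C0 cC; have [c [Cc hc]] := maximizers_nonempty b C0 cC.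
have -> : maximizers C b = C `&` (fun x => killing x b) @^-1` [set r | killing c b <= r].
  apply/seteqP; split=> [x [Cx hx]|x [Cx hx]]; split=> //; first exact: hx.
  by move=> y Cy; apply: le_trans (hc _ Cy) hx.
apply: compact_closedI => //; apply: closed_comp.
  by move=> x _; exact: killing_continuous.
exact: closed_ge.
Qed.

(** First-order condition: for X = [x, b], which lies in k and commutes with S,
    the flow of X stays in C, so the derivative B([X, x], b) = B(X, [x, b]) =
    B(X, X) vanishes at the maximizer x; as B is definite on k, X = 0. *)
Lemma maximizers_commute S C b x : C `<=` p -> p b ->
  (forall y, C y -> centralizes y S) -> centralizes b S ->
  flow_stable S C -> maximizers C b x -> lie x b = 0.
Proof.
move=> Cp pb CS bS stC [Cx hx].
pose X := lie x b; have kX : k X by apply: lie_pp => //; exact: Cp.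
have XS : centralizes X S.
  move=> s Ss; have := jacobi x b s; rewrite bS// (CS x Cx s)// !linear0 addr0.
  by move<-.
have [phi phiP] := flow_exists kX.
apply: (killing_k_eq0 thetaP kX).
have [phi0 dphi] := phiP.
have df (t : R^o) : is_derive t 1 (fun s : R^o => killing b (phi s x) : R^o) (killing b (lie X (phi t x))).
  have := is_derive_linear (@linear_continuous_findim _ _ _ (killing b)) (dphi t x).
  by [].
have h : is_derive (0 : R) 1 (fun s : R => killing b (phi s x)) 0.
  have i0 : (0 : R) \in `]-1, 1[%R by rewrite in_itv/= ltrN10 ltr01.
  apply: (derive1_at_max _ _ i0); first by lra.
  - by move=> t _; have [] := df t.
  - move=> t _; rewrite phi0 !(killingC b); apply: hx.
    exact: stC XS phiP _ _ Cx.
have -> : killing X X = killing b (lie X x).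
  by rewrite (killingC b) (killing_lie X).
by have [_] := df 0; have [_ ->] := h; rewrite phi0 => <-.
Qed.

(** If X commutes with b then its flow preserves the product with b. *)
Lemma maximizers_stable S C b : p b ->
  flow_stable S C -> flow_stable (b |` S) (maximizers C b).
Proof.
move=> pb stC X phi kX Xb phiP t x [Cx hx].
have XS : centralizes X S by move=> s Ss; apply: Xb; right.
split=> [|y Cy]; first exact: stC XS phiP _ _ Cx.
suff -> : killing (phi t x) b = killing x b by exact: hx.
rewrite -!(cform_p _ pb).
have [phi0 dphi] := phiP.
have := @lie_solutions_isometric _ _ _ thetaP X (phi^~ x) (cst b) t kX; rewrite phi0; apply.
by move=> s; rewrite /= (Xb b); [exact: is_derive_cst|left].
Qed.

(** Maximizing successively along the elements of bs keeps a stable nonempty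
    compact set, whose elements commute with more and more elements of bs.  This
    replaces the maximization along a single regular element of a. *)
Lemma stable_meets_centralizer (bs : seq L) S C :
  C !=set0 -> compact C -> C `<=` p ->
  (forall b, b \in bs -> p b) ->
  (forall b c, b \in bs -> c \in bs -> lie b c = 0) ->
  (forall b, b \in bs -> centralizes b S) ->
  (forall y, C y -> centralizes y S) -> flow_stable S C ->
  exists2 x, C x & forall b, b \in bs -> lie x b = 0.
Proof.
elim: bs S C => [|b bs IH] S C C0 cC Cp bp bb bS CS stC.
  by have [x Cx] := C0; exists x.
have bsW c : c \in bs -> c \in b :: bs by rewrite in_cons orbC => ->.
have hb : b \in b :: bs by rewrite in_cons eqxx.
have pb : p b by exact: bp.
have comm x : maximizers C b x -> lie x b = 0.
  by apply: maximizers_commute stC => //; exact: bS.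
have [||||||||x [Cx hx] xbs] := IH (b |` S) (maximizers C b).
- exact: maximizers_nonempty.
- exact: maximizers_compact.
- by move=> x [Cx _]; exact: Cp.
- by move=> c /bsW; exact: bp.
- by move=> c d /bsW cb /bsW; exact: bb.
- by move=> c /bsW cb s [->|Ss]; [exact: bb|exact: bS Ss].
- by move=> y my s [->|Ss]; [exact: comm|case: my => Cy _; exact: CS Ss].
- exact: maximizers_stable.
by exists x => // c; rewrite in_cons => /predU1P[->|]; [exact: comm|exact: xbs].
Qed.

Lemma maximal_abelian_mem (a : {vspace L}) x : maximal_abelian_in p a -> p x ->
  (forall b, b \in vbasis a -> lie x b = 0) -> x \in a.
Proof.
move=> [aab ap amax] px xb.
have xa y : y \in a -> lie x y = 0.
  move=> /coord_vbasis ->; rewrite linear_sum big1// => i _.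
  by rewrite linearZ/= xb ?scaler0// mem_nth// size_tuple.
suff <- : (a + <[x]>)%VS = a by rewrite memvE addvSr.
apply: amax; last exact: addvSl.
- move=> _ _ /memv_addP[u ua [_ /vlineP[c ->] ->]] /memv_addP[v va [_ /vlineP[d ->] ->]].
  rewrite lieDl lieZl !linearD/= !linearZ/= liexx (xa v)// (aab u v)//.
  by rewrite (lieC u x) xa// oppr0 !scaler0 !addr0.
- move=> _ /memv_addP[u ua [_ /vlineP[c ->] ->]].
  by rewrite /cartan_p/= linearD linearZ/= (ap _ ua) px opprD scalerN.
Qed.

(** With S empty and C an orbit this is the conjugacy of every element of p to an
    element of a; with S = {b} it is the same fact inside the centralizer of b. *)
Lemma stable_meets_abelian (a : {vspace L}) S C : maximal_abelian_in p a ->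
  S `<=` [set` a] ->
  C !=set0 -> compact C -> C `<=` p ->
  (forall y, C y -> centralizes y S) -> flow_stable S C ->
  exists2 x, C x & x \in a.
Proof.
move=> amax Sa C0 cC Cp CS stC; have [aab ap _] := amax.
have ba b : b \in vbasis a -> b \in a by exact: vbasis_mem.
have [|||x Cx xb] := @stable_meets_centralizer (vbasis a) S C C0 cC Cp _ _ _ CS stC.
- by move=> b /ba /ap.
- by move=> b c /ba bA /ba; exact: aab.
- by move=> b /ba bA s /Sa; exact: aab.
- exists x => //; apply: maximal_abelian_mem => //; exact: Cp.
Qed.

End Core.

(** * The symmetry group of a body *)

Lemma ultra_fmap (T U : Type) (f : T -> U) (F : set_system T) :
  UltraFilter F -> UltraFilter (f @ F).
Proof.
move=> UF; split; first exact: fmap_proper_filter.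
move=> G PG FG; apply/seteqP; split=> // A GA.
have [//|FA] := in_ultra_setVsetC (f @^-1` A) UF.
have GnA : G (~` A) by exact: FG.
by have /filter_ex[x []] : G (A `&` ~` A) by exact: filterI.
Qed.

Section Symmetries.
Context {R : realType} {L : normedLieAlgType R} (theta : 'End(L)).
Hypothesis thetaP : cartan_involution theta.
Implicit Types (x y z b X : L) (C S E : set L).
Local Notation ip := (cform theta).

(** By Riesz and Cauchy-Schwarz the coordinates are bounded on a sphere of the
    form. *)
Lemma cform_sphere_compact (r : R) : compact [set x | ip x x = r].
Proof.
pose b := vbasis {:L}.
have /choice[beta hb] (i : 'I_(\dim {:L})) : exists beta, forall y, coord b i y = ip y beta.
  have [beta _ h] := riesz thetaP fullv (coord b i : {linear L -> R^o}).
  by exists beta => y; apply: h; rewrite memvf.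
pose M := 1 + \sum_i `|r * ip (beta i) (beta i)|.
apply: (subclosed_compact _ (@coord_box_compact _ _ M)); last first.
  move=> x xr i /=; rewrite hb.
  have := cauchy_schwarz thetaP x (beta i); rewrite xr => h.
  have {}h : `|ip x (beta i)| ^+ 2 <= \sum_i `|r * ip (beta i) (beta i)|.
    rewrite real_normK ?num_real//; apply: le_trans h _; apply: le_trans (ler_norm _) _.
    by rewrite (bigD1 i)//= lerDl sumr_ge0.
  rewrite /M; set s := \sum_i _ in h *; set t := `|_| in h *.
  (* t ^+ 2 <= s implies t <= 1 + s *)
  by nra.
apply: (@closed_comp _ R^o (fun x => ip x x) [set s | s = r]).
  by move=> x _; apply: cvg_cform => //; exact: cvg_id.
exact: (@closed_eq R r).
Qed.

Definition body_symmetry E (T T' : L -> L) :=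
  [/\ isometry_pair theta T T', forall x, E x -> E (T x) & forall x, E x -> E (T' x)].

Definition sym_orbit E x : set L := [set y | exists T T', body_symmetry E T T' /\ T x = y].

(** Compactness of the group of symmetries, as in Tychonoff's theorem: along an
    ultrafilter the images of every vector under symmetries and their inverses
    converge, since they stay in a compact sphere, and the limit maps are again
    inverse symmetries. *)
Lemma sym_orbit_compact E x : closed E -> compact (sym_orbit E x).
Proof.
move=> clE; rewrite compact_ultra => F UF FO.
have /choice[U hU] y : exists U : (L -> L) * (L -> L),
    sym_orbit E x y -> body_symmetry E U.1 U.2 /\ U.1 x = y.
  have [[T [T' h]]|nO] := pselect (sym_orbit E x y); first by exists (T, T').
  by exists (id, id).
have lim_of (f : L -> L -> L) z :
    (forall y, sym_orbit E x y -> ip (f y z) (f y z) = ip z z) ->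
    exists2 w, ip w w = ip z z & f^~ z @ F --> w.
  move=> hf; have := @cform_sphere_compact (ip z z); rewrite compact_ultra.
  move=> /(_ _ (ultra_fmap (f^~ z) UF)) [|w [hw Fw]]; last by exists w.
  change (F [set y | ip (f y z) (f y z) = ip z z]).
  by apply: filterS FO => y /hf.
have iso y z : sym_orbit E x y ->
    ip ((U y).1 z) ((U y).1 z) = ip z z /\ ip ((U y).2 z) ((U y).2 z) = ip z z.
  by move=> /hU[[[adj TK T'K] _ _] _]; split; rewrite ?adj ?TK// -adj T'K.
have /choice[T hT] z : exists w, ip w w = ip z z /\ (fun y => (U y).1 z) @ F --> w.
  have [|w ? ?] := lim_of (fun y => (U y).1) z; last by exists w.
  by move=> y /(iso _ z)[].
have /choice[T' hT'] z : exists w, ip w w = ip z z /\ (fun y => (U y).2 z) @ F --> w.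
  have [|w ? ?] := lim_of (fun y => (U y).2) z; last by exists w.
  by move=> y /(iso _ z)[].
have adj z w : ip (T z) w = ip z (T' w).
  apply: (@cvg_unique R^o (@norm_hausdorff _ _) ((fun y => ip ((U y).1 z) w : R^o) @ F)).
    apply: (cvg_cform thetaP (f := fun y => (U y).1 z) (g := cst w)); last exact: cvg_cst.
    exact: (hT z).2.
  have h : (fun y => ip z ((U y).2 w) : R^o) @ F --> (ip z (T' w) : R^o).
    apply: (cvg_cform thetaP (f := cst z) (g := fun y => (U y).2 w)); first exact: cvg_cst.
    exact: (hT' w).2.
  apply: cvg_trans h; apply: near_eq_cvg; apply: filterS FO => y /hU[[[-> _ _] _ _] _].
  by [].
have adj' z w : ip (T' z) w = ip z (T w).
  by rewrite (cformC thetaP) -adj (cformC thetaP).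
have TE (V : L -> L -> L) (W : L -> L) : (forall z, V^~ z @ F --> W z) ->
    (forall y z, sym_orbit E x y -> E z -> E (V y z)) -> forall z, E z -> E (W z).
  move=> VW hV z Ez; apply: (closed_cvg _ clE _ _ (VW z)).
  by apply: filterS FO => y /hV; exact.
exists (T x); split.
  exists T, T'; split => //; split.
  - split=> //.
    + by apply: (isometry_adjointK thetaP adj) => z; exact: (hT z).1.
    + by apply: (isometry_adjointK thetaP adj') => z; exact: (hT' z).1.
  - apply: (TE (fun y => (U y).1)) => [z|y z /hU[[_ h _] _]]; [exact: (hT z).2|exact: h].
  - apply: (TE (fun y => (U y).2)) => [z|y z /hU[[_ _ h] _]]; [exact: (hT' z).2|exact: h].
move=> A TxA; have FA : F [set y | A ((U y).1 x)] by exact: (hT x).2 _ TxA.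
by apply: filterS (filterI FA FO) => y [/= Ay /hU[_ yx]]; rewrite yx in Ay.
Qed.

End Symmetries.

(** * Lifting exposed faces from an abelian section *)

Section LiftExposedFaces.
Context {R : realType} {L : normedLieAlgType R} (theta : 'End(L)).
Hypothesis thetaP : cartan_involution theta.
Implicit Types (x y z b X : L) (C S F : set L).
Local Notation ip := (cform theta).
Local Notation k := (cartan_k theta).
Local Notation p := (cartan_p theta).

Variables (E : set L) (a : {vspace L}).
Hypothesis flowE : forall X, k X ->
  exists2 phi, is_flow X phi & forall t x, E x -> E (phi t x).
Hypothesis E_sub_p : E `<=` p.
Hypothesis E_body : convex_body E.
Hypothesis a_max : maximal_abelian_in p a.

Let convE : convex_set (E : set (convex_lmodType L)). Proof. by case: E_body. Qed.
Let compE : compact E. Proof. by case: E_body. Qed.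
Let flow_exists X : k X -> exists phi, is_flow X phi.
Proof. by move=> /flowE[phi phiP _]; exists phi. Qed.

Let ap : [set` a] `<=` p. Proof. by case: a_max. Qed.

(** All flows of X coincide, and one of them preserves E. *)
Lemma body_stable S : flow_stable theta S E.
Proof.
move=> X psi kX _ [psi0 dpsi] t x Ex; have [phi [phi0 dphi] phiE] := flowE kX.
have -> : psi t x = phi t x; last exact: phiE.
apply: (@lie_solutions_unique _ _ _ thetaP X (psi^~ x) (phi^~ x)) => //.
by rewrite psi0 phi0.
Qed.

Lemma sym_orbit_stable x : flow_stable theta set0 (sym_orbit theta E x).
Proof.
move=> X phi kX _ phiP t _ [T [T' [[[adj TK T'K] TE T'E] <-]]].
have [fadj fK f'K] := flow_pair thetaP kX phiP t.
have st : flow_stable theta set0 E := @body_stable _.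
have st' s y : E y -> E (phi s y) by move=> Ey; apply: (st X).
exists (phi t \o T), (T' \o phi (- t)); split=> //; split.
- split=> [y z|y|y] /=; first by rewrite fadj adj.
    by rewrite fK TK.
  by rewrite T'K f'K.
- by move=> y /TE; exact: st'.
- by move=> y Ey; apply/T'E/st'.
Qed.

Lemma sym_orbit_meets x : E x -> exists T T', body_symmetry theta E T T' /\ T x \in a.
Proof.
move=> Ex; have clE : closed E by apply: compact_closed compE; exact: norm_hausdorff.
have [||||||_ [T [T' [sT <-]]] Ta] :=
    stable_meets_abelian thetaP flow_exists (S := set0) (C := sym_orbit theta E x) a_max.
- by [].
- by exists x, id, id; split=> //; split=> //; split.
- exact: sym_orbit_compact.
- by move=> _ [T [T' [[_ TE _] <-]]]; exact/E_sub_p/TE.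
- by move=> y _ s [].
- exact: sym_orbit_stable.
by exists T, T'.
Qed.

Lemma body_symmetryC T T' : body_symmetry theta E T T' -> body_symmetry theta E T' T.
Proof.
by case=> [[adj TK T'K] TE T'E]; split=> //; split=> // x y; rewrite (cformC thetaP) -adj (cformC thetaP).
Qed.

Lemma face_preimage T T' F : body_symmetry theta E T T' -> face E F -> face E (T @^-1` F).
Proof.
move=> [[adj TK T'K] TE T'E] [[x0 Fx0] FE cF hF].
have Tlin := adjoint_linear thetaP adj.
have Tconv x y (t : R) : T ((1 - t) *: x + t *: y) = (1 - t) *: T x + t *: T y.
  pose TL : {linear L -> L} := HB.pack T (GRing.isLinear.Build R L _ _ T Tlin).
  by rewrite -[T]/(TL : L -> L) linearD !linearZ.
split.
- by exists (T' x0); rewrite /= T'K.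
- by move=> y /FE /T'E; rewrite TK.
- apply/convex_setE => y z t Fy Fz t01 /=; rewrite Tconv.
  by move/convex_setE: cF; apply.
move=> y z Ey Ez [w [[t t01 <-] Fw]] _ [s s01 <-] /=; rewrite Tconv.
apply: (hF (T y) (T z)); [exact: TE|exact: TE| |by exists s].
by exists (T ((1 - t) *: y + t *: z)); split=> //; exists t => //; rewrite Tconv.
Qed.

Lemma maximizers_convex b : convex_set (maximizers E b : set (convex_lmodType L)).
Proof.
apply/convex_setE => x y t [Ex hx] [Ey hy] t01.
split; first by move/convex_setE: convE; apply.
move=> z Ez; rewrite killingDl !killingZl.
have := hx z Ez; have := hy z Ez; move: t01 => /andP[]; nra.
Qed.

Lemma relint_points_compact C d : compact C -> compact (relint_points d C).
Proof.
move=> cC; have clC : closed C by apply: compact_closed cC; exact: norm_hausdorff.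
have -> : relint_points d C =
    C `&` \bigcap_(y in C) (fun x => x - d *: (y - x)) @^-1` C.
  by apply/seteqP; split=> x [Cx h]; split=> // y; exact: h.
apply: compact_closedI => //; apply: closed_bigI => y _.
apply: closed_comp => // x _.
apply: cvgB; first exact: cvg_id.
by apply: cvgZl_tmp; apply: cvgB; [exact: cvg_cst|exact: cvg_id].
Qed.

(** If X is in k and commutes with S, the flow of X acts by linear automorphisms of
    C. *)
Lemma relint_points_stable S C d : flow_stable theta S C ->
  flow_stable theta S (relint_points d C).
Proof.
move=> stC X phi kX XS phiP t x [Cx hx]; split; first exact: (stC X).
move=> y Cy; have [fadj fK f'K] := flow_pair thetaP kX phiP t.
have philin := adjoint_linear thetaP fadj.
pose phiL : {linear L -> L} := HB.pack (phi t) (GRing.isLinear.Build R L _ _ (phi t) philin).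
have := stC X phi kX XS phiP t _ (hx _ (stC X phi kX XS phiP (- t) _ Cy)).
by rewrite -[phi t]/(phiL : L -> L) linearB linearZ linearB [phiL (phi _ _)]f'K.
Qed.

(** The heart of the matter.  Let b in a expose the face of E `&` a cut by F, and
    let C be the set of maximizers of b on E.  Its intersection with a is that of
    F, because the maximum of b on E is reached in a.  A relative interior point of
    F that lies in a yields F `<=` C.  Conversely the relative interior points of
    C form a set that is stable under the centralizer of b in k, so one of them
    lies in a, hence in F, and a face that contains it contains C. *)
Lemma face_through_abelian F x (d : R) :
  all_faces_exposed killing [set` a] (E `&` [set` a]) ->
  face E F -> x \in a -> 0 < d -> relint_points d F x ->
  exists2 b, b \in a & F = maximizers E b.
Proof.
move=> exP fF xa d0 [Fx hd]; have [_ FE convF hF] := fF.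
have fP : face (E `&` [set` a]) (F `&` [set` a]).
  split.
  - by exists x.
  - by move=> y [/FE].
  - apply/convex_setE => y z t [Fy ya] [Fz za] t01.
    split; first by move/convex_setE: convF; apply.
    by rewrite /= memvD// memvZ.
  move=> y z [Ey ya] [Ez za] [w [hw [Fw wa]]] v vyz.
  split; first by apply: (hF y z Ey Ez _ v vyz); exists w.
  by case: vyz => s _ <-; rewrite /= memvD// memvZ.
have [b ba hb] := exP _ fP; exists b => //.
have pb : p b by exact: ap.
pose C := maximizers E b.
have CE : C `<=` E by move=> y [].
have C0 : C !=set0 by apply: maximizers_nonempty => //; exists x; exact: FE.
have cC : compact C by apply: maximizers_compact => //; exists x; exact: FE.
have Cp : C `<=` p by move=> y /CE; exact: E_sub_p.
have Cb y : C y -> centralizes y [set b].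
  move=> Cy _ ->; apply: (maximizers_commute thetaP flow_exists (S := set0)) Cy => //.
    by move=> z _ s [].
  exact: body_stable.
have stC : flow_stable theta [set b] C.
  have := maximizers_stable thetaP pb (@body_stable set0).
  by rewrite setU0.
have ba' : [set b] `<=` [set` a] by move=> _ ->.
have CaF y : C y -> y \in a -> F y.
  move=> [Ey hy] ya; suff [] : (F `&` [set` a]) y by [].
  by rewrite hb; split=> // z [Ez _]; exact: hy.
have Cx : C x.
  have [c Cc ca] := stable_meets_abelian thetaP flow_exists a_max ba' C0 cC Cp Cb stC.
  have : (F `&` [set` a]) x by [].
  rewrite hb => -[_ hx]; split; first exact: FE.
  by move=> y Ey; apply: le_trans (Cc.2 _ Ey) (hx _ _); split=> //; exact: CE.
apply/seteqP; split=> y.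
  move=> Fy; split; first exact: FE.
  move=> z Ez; apply: le_trans (Cx.2 _ Ez) _.
  have := Cx.2 _ (FE _ (hd _ Fy)).
  rewrite -scaleNr killingDl killingZl -[in y - x]scaleN1r killingDl killingZl.
  by nra.
move=> Cy.
have [e e0 Ce] := exists_relint C0 (@maximizers_convex b) (@subset_refl _ C) cC.
have [|||||z [Cz hz] za] := stable_meets_abelian thetaP flow_exists a_max ba'
  (C := relint_points e C).
- exact: Ce.
- exact: relint_points_compact.
- by move=> z [Cz _]; exact: Cp.
- by move=> z [Cz _]; exact: Cb.
- exact: relint_points_stable.
exact: (relint_face fF (CaF _ Cz za) (CE _ Cy) e0 (CE _ (hz _ Cy))).
Qed.

(** A symmetry T moves a relative interior point of F into a, and F is exposed by
    the image under the inverse of T of a vector that exposes the image of F,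
    once this vector is projected to p. *)
Lemma exposed_of_section :
  all_faces_exposed killing [set` a] (E `&` [set` a]) ->
  all_faces_exposed killing p E.
Proof.
move=> exP F fF; have [F0 FE convF _] := fF.
have [d d0 [x [Fx hd]]] := exists_relint F0 convF FE compE.
have [T [T' [sT Txa]]] := sym_orbit_meets (FE _ Fx).
have [[adj TK T'K] TE T'E] := sT.
have fF' := face_preimage (body_symmetryC sT) fF.
have T'lin : linear T'.
  by apply: (adjoint_linear thetaP (T' := T)) => y z; rewrite (cformC thetaP) -adj (cformC thetaP).
pose T'L : {linear L -> L} := HB.pack T' (GRing.isLinear.Build R L _ _ T' T'lin).
have Fdx : relint_points d (T' @^-1` F) (T x).
  split=> [|y Fy]; rewrite /= ?TK//.
  rewrite -[T']/(T'L : L -> L) linearB linearZ linearB [T'L (T x)]TK.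
  exact: hd.
have [b ba hb] := face_through_abelian exP fF' Txa d0 Fdx.
have FT y : F y <-> maximizers E b (T y) by rewrite -hb /= TK.
have Tb y : E y -> killing (T y) b = killing y (p_part theta (T' b)).
  move=> Ey; rewrite -(cform_p _ (ap ba)) adj -(cform_p_part thetaP _ (E_sub_p Ey)).
  by rewrite cform_p//; exact: p_partP.
exists (p_part theta (T' b)); first exact: p_partP.
apply/seteqP; split=> y.
  move=> /[dup] /FE Ey /FT[_ hy]; split=> // z Ez.
  by rewrite -!Tb//; apply: hy; exact: TE.
move=> [Ey hy]; apply/FT; split; first exact: TE.
move=> z Ez; rewrite -(T'K z) !Tb//; last exact: T'E.
by apply: hy; exact: T'E.
Qed.

End LiftExposedFaces.

(** * The adjoint action read in charts *)

Section Charts.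
Context {R : realType} {M : topologicalType} {V : normedModType R} (c : chart M V).

Lemma cinvK v : cimg c v -> cmap c (cinv c v) = v.
Proof. by move=> [x dx <-]; rewrite cmapK. Qed.

Lemma cdom_cinv v : cimg c v -> cdom c (cinv c v).
Proof. by move=> [x dx <-]; rewrite cmapK. Qed.

Lemma cimg_cmap x : cdom c x -> cimg c (cmap c x).
Proof. by move=> dx; exists x. Qed.

Lemma near_cdom x : cdom c x -> nbhs x (cdom c).
Proof. by move=> dx; apply: open_nbhs_nbhs; split=> //; exact: cdom_open. Qed.

Lemma near_cimg v : cimg c v -> nbhs v (cimg c).
Proof. by move=> dv; apply: open_nbhs_nbhs; split=> //; exact: cimg_open. Qed.

End Charts.

Section Scale.
Context {R : realType} {L : normedLieAlgType R} {V : normedModType R}.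

Lemma differentiable_scale (s : V -> R^o) (f : V -> L) v :
  differentiable s v -> differentiable f v ->
  differentiable (fun u => s u *: f u) v.
Proof.
move=> ds df; pose b := vbasis {:L}.
have -> : (fun u => s u *: f u) = \sum_i (fun u => (s u * coord b i (f u)) *: b`_i).
  apply/funext => u; rewrite fct_sumE.
  rewrite {1}[f u](coord_basis (vbasisP fullv) (memvf _)) scaler_sumr.
  by apply: eq_bigr => i _; rewrite scalerA.
apply: differentiable_sum => i; apply: differentiableZl.
apply: (differentiableM (f := s) (g := fun u => coord b i (f u))) => //.
apply: (differentiable_comp (g := coord b i : L -> R^o)) => //.
by apply: linear_differentiable; exact: vbasis_coord_continuous.
Qed.

End Scale.

Section Slices.
Context {R : realType} {U V W : normedModType R} (F : U * V -> W).

Lemma is_diff_slicer u v : differentiable F (u, v) ->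
  is_diff v (fun y => F (u, y)) (fun y => 'd F (u, v) (0, y)).
Proof.
move=> dF; have dp : is_diff v (fun y => (u, y)) (fun y => (0, y) : U * V).
  by apply: is_diff_pair.
have d2 : is_diff (u, v) F ('d F (u, v)) by split.
exact: (is_diff_comp (f := fun y => (u, y)) (g := F)).
Qed.

Lemma is_diff_slicel u v : differentiable F (u, v) ->
  is_diff u (fun x => F (x, v)) (fun x => 'd F (u, v) (x, 0)).
Proof.
move=> dF; have dp : is_diff u (fun x => (x, v)) (fun x => (x, 0) : U * V).
  by apply: is_diff_pair.
have d2 : is_diff (u, v) F ('d F (u, v)) by split.
exact: (is_diff_comp (f := fun x => (x, v)) (g := F)).
Qed.

End Slices.

Section LieGroup.
Context {R : realType} {L : normedLieAlgType R} {G : topoGroupType}.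
Variables (A : set (chart G L)) (e : chart G L).
Hypothesis GP : lie_group A.
Hypothesis eP : lie_algebra_of A e.
Implicit Types (g h : G) (X Y : L).

Let Ae : A e. Proof. by case: eP. Qed.
Let de1 : cdom e 1%g. Proof. by case: eP. Qed.
Local Notation e0 := (cmap e 1%g).
Let ce0 : cimg e e0. Proof. exact: cimg_cmap. Qed.
Let cinv_e0 : cinv e e0 = 1%g. Proof. exact: cmapK. Qed.

Definition chart_mul (a b c : chart G L) (z : L * L) : L :=
  cmap c (cinv a z.1 * cinv b z.2)%g.

Lemma chart_mul_smooth a b c (z : L * L) : A a -> A b -> A c ->
  cimg a z.1 -> cimg b z.2 -> cdom c (cinv a z.1 * cinv b z.2)%g ->
  differentiable (chart_mul a b c) z /\
  forall v, differentiable ('D_v (chart_mul a b c)) z.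
Proof.
move=> Aa Ab Ac z1 z2 z12; case: GP => _ _ _ /(_ a b c Aa Ab Ac 2%N) /= [d1 d2] _.
by split=> [|v]; [apply: d1|have [d _] := d2 v; apply: d].
Qed.

Lemma mul_cvg (T : Type) (F : set_system T) (f f' : T -> G) g h : Filter F ->
  f @ F --> g -> f' @ F --> h -> (fun t => f t * f' t)%g @ F --> (g * h)%g.
Proof.
move=> FF fg fh; case: GP => _ mc _ _ _.
by apply: (@continuous2_cvg _ G G G F FF f f' (fun x y => x * y)%g g h _ fg fh); exact: mc (g, h).
Qed.

Lemma cinv_cvg_e0 : cinv e @ nbhs e0 --> (1%g : G).
Proof. by have := cinv_continuous ce0; rewrite /prop_for /continuous_at cinv_e0. Qed.

Definition conj_chart g (v : L) : L := cmap e (g * cinv e v * g^-1)%g.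

Lemma atlas_chart g : exists2 c, A c & cdom c g.
Proof. by case: GP => -[_ _ [h _]] _ _ _ _; exact: h. Qed.

(** The conjugation by g is a left multiplication, read from the chart e to a
    chart around g, followed by a right multiplication.  This composite is
    differentiable, and [Ad e g] is its differential. *)
Lemma conj_chart_rep g : exists r : L -> L,
  [/\ differentiable r e0, r e0 = e0 & \forall w \near e0, conj_chart g w = r w].
Proof.
have [a Aa ag] := atlas_chart g; have [b Ab bg] := atlas_chart g^-1%g.
pose r := (fun u => chart_mul a b e (u, cmap b g^-1%g)) \o
          (fun w => chart_mul a e a (cmap a g, w)).
have r0 : chart_mul a e a (cmap a g, e0) = cmap a g.
  by rewrite /chart_mul /= cinv_e0 cmapK// mulg1.
exists r; split.
- apply: differentiable_comp.
    apply: (@differentiable_comp _ _ _ _ (fun w => (cmap a g, w)) (chart_mul a e a)).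
      by apply: differentiable_pair => //; exact: differentiable_cst.
    have [] // := @chart_mul_smooth a e a (cmap a g, e0) => //=.
      exact: cimg_cmap.
    by rewrite cinv_e0 cmapK// mulg1.
  rewrite r0.
  apply: (@differentiable_comp _ _ _ _ (fun u => (u, cmap b g^-1%g)) (chart_mul a b e)).
    by apply: differentiable_pair => //; exact: differentiable_cst.
  have [] // := @chart_mul_smooth a b e (cmap a g, cmap b g^-1%g) => //=.
  - exact: cimg_cmap.
  - exact: cimg_cmap.
  by rewrite !cmapK// mulgV.
- by rewrite /r /= r0 /chart_mul /= !cmapK// mulgV.
have hc : \forall w \near e0, cdom a (g * cinv e w)%g.
  have : (fun w => g * cinv e w)%g @ nbhs e0 --> g.
    rewrite -[X in _ --> X]mulg1; apply: mul_cvg; first exact: cvg_cst.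
    exact: cinv_cvg_e0.
  by apply; exact: near_cdom.
apply: filterS hc => w aw.
by rewrite /r /conj_chart /chart_mul /= !(cmapK (c := b))// (cmapK (c := a) ag) cmapK.
Qed.

Lemma AdE g Y (r : L -> L) : differentiable r e0 ->
  (\forall w \near e0, conj_chart g w = r w) -> Ad e g Y = 'd r e0 Y.
Proof. by move=> dr gr; rewrite /Ad (near_eq_derive Y gr) deriveE. Qed.

Lemma AdM g h Y : Ad e (g * h)%g Y = Ad e g (Ad e h Y).
Proof.
have [r [dr r0 gr]] := conj_chart_rep g.
have [s [ds s0 hs]] := conj_chart_rep h.
have sc : s @ nbhs e0 --> e0 by rewrite -{2}s0; exact: differentiable_continuous.
rewrite (AdE Y (r := r \o s)); first last.
- have hc : \forall w \near e0, cdom e (h * cinv e w * h^-1)%g.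
    have := mul_cvg _ (mul_cvg _ (cvg_cst h) cinv_cvg_e0) (cvg_cst h^-1%g).
    by rewrite mulg1 mulgV; apply; exact: near_cdom.
  have gs : \forall w \near e0, conj_chart g (s w) = r (s w) by exact: sc _ gr.
  near=> w.
  have -> : conj_chart (g * h)%g w = conj_chart g (conj_chart h w).
    rewrite /conj_chart cmapK; last by near: w.
    by rewrite invgM !mulgA.
  by rewrite (near hs w)//; near: w.
- by apply: differentiable_comp; rewrite ?s0.
by rewrite diff_comp ?s0//= -(AdE Y ds hs) -(AdE _ dr gr).
Unshelve. all: by end_near. Qed.

Lemma Ad1 Y : Ad e 1%g Y = Y.
Proof.
have h : \forall w \near e0, conj_chart 1%g w = id w.
  apply: filterS (near_cimg ce0) => w cw.
  by rewrite /conj_chart invg1 mulg1 mul1g cinvK.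
by rewrite (AdE Y _ h)// -deriveE// derive_id.
Qed.

Local Notation m := (chart_mul e e e).
Let inv_chart (v : L) : L := cmap e (cinv e v)^-1%g.

(** The differential of a conjugation as a product of partial differentials of
    the multiplication. *)
Lemma Ad_partial v Y : cimg e v -> cdom e (cinv e v)^-1%g ->
  Ad e (cinv e v) Y = 'D_('D_(0, Y) m (v, e0), 0) m (v, inv_chart v).
Proof.
move=> cv civ; set g := cinv e v.
have ciiv : cimg e (inv_chart v) by exact: cimg_cmap.
have gE : cinv e (inv_chart v) = g^-1%g by rewrite cmapK.
have mv : m (v, e0) = v by rewrite /chart_mul /= cinv_e0 mulg1 cinvK.
have d1 : differentiable m (v, e0).
  have [] // := @chart_mul_smooth e e e (v, e0) Ae Ae Ae cv ce0.
  by rewrite /= cinv_e0 mulg1; exact: cdom_cinv.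
have d2 : differentiable m (v, inv_chart v).
  have [] // := @chart_mul_smooth e e e (v, inv_chart v) Ae Ae Ae cv ciiv.
  by rewrite /= gE mulgV.
have s1 := is_diff_slicer d1.
have s2 : is_diff (m (v, e0)) (fun u => m (u, inv_chart v))
    (fun x => 'd m (v, inv_chart v) (x, 0)) by rewrite mv; exact: is_diff_slicel.
have s12 := is_diff_comp s1 s2.
have hc : \forall w \near e0, cdom e (g * cinv e w)%g.
  have := mul_cvg _ (cvg_cst g) cinv_cvg_e0.
  by rewrite mulg1; apply; apply: near_cdom; exact: cdom_cinv.
rewrite (AdE Y (r := (fun u => m (u, inv_chart v)) \o (fun w => m (v, w)))).
- by rewrite diff_val /= !deriveE.
- exact: ex_diff.
- by apply: filterS hc => w cw; rewrite /conj_chart /chart_mul /= gE cmapK.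
Qed.

(** In coordinates, [Ad_partial] involves only first-order partial derivatives of
    the multiplication, which are differentiable. *)
Lemma Ad_chart_differentiable Y : exists2 H : L -> L, differentiable H e0 &
  \forall v \near e0, Ad e (cinv e v) Y = H v.
Proof.
pose b := vbasis {:L}.
have i0 : inv_chart e0 = e0 by rewrite /inv_chart cinv_e0 invg1.
have di : differentiable inv_chart e0.
  case: GP => _ _ _ _ /(_ e e Ae Ae 1%N) [d _]; apply: d.
  by split=> //=; rewrite cinv_e0 invg1.
have [_ dDm] : differentiable m (e0, e0) /\ forall v, differentiable ('D_v m) (e0, e0).
  by apply: chart_mul_smooth => //=; rewrite cinv_e0 mulg1.
pose Z v := 'D_(0, Y) m (v, e0).
have dZ : differentiable Z e0.
  by have := is_diff_slicel (dDm (0, Y)); case.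
exists (\sum_j (fun v => coord b j (Z v) *: 'D_(b`_j, 0) m (v, inv_chart v))).
  apply: differentiable_sum => j; apply: differentiable_scale.
    apply: (differentiable_comp (g := coord b j : L -> R^o)) => //.
    by apply: linear_differentiable; exact: vbasis_coord_continuous.
  apply: (differentiable_comp (f := fun v => (v, inv_chart v)) (g := 'D_(b`_j, 0) m)).
    exact: differentiable_pair.
  by rewrite i0; exact: dDm.
have hc : \forall v \near e0, cdom e (cinv e v)^-1%g.
  have ic : {for 1%g, continuous (fun g : G => g^-1)%g} by case: GP => _ _ h _ _; exact: h.
  by have := continuous_cvg _ ic cinv_cvg_e0; rewrite invg1; apply; exact: near_cdom.
apply: filterS2 hc (near_cimg ce0) => v civ cv.
rewrite Ad_partial// fct_sumE -/(Z v).
have d2 : differentiable m (v, inv_chart v).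
  have [] // := @chart_mul_smooth e e e (v, inv_chart v) Ae Ae Ae cv (cimg_cmap civ).
  by rewrite /= cmapK// mulgV.
have [_ slE] := is_diff_slicel d2.
have DE x : 'D_(x, 0) m (v, inv_chart v) = 'd (fun u => m (u, inv_chart v)) v x.
  by rewrite deriveE// slE.
rewrite DE {1}[Z v](coord_basis (vbasisP fullv) (memvf _)) linear_sum.
by apply: eq_bigr => j _; rewrite linearZ DE.
Qed.

(** The Lie bracket is a directional derivative of Ad; differentiability allows to
    replace the straight line by any curve with the same velocity. *)
Lemma is_derive_Ad gamma X Y : one_parameter_subgroup A e gamma X ->
  is_derive (0 : R^o) 1 (fun t : R^o => Ad e (gamma t) Y) (lie X Y).
Proof.
move=> [[cg _] gD dg].
have g0 : gamma 0 = 1%g.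
  by apply: (@mulgI G (gamma 0)); rewrite -gD addr0 mulg1.
pose c := cmap e \o gamma; have c0 : c 0 = e0 by rewrite /c /= g0.
have gamma1 : gamma @ nbhs (0 : R^o) --> (1%g : G) by have := cg 0; rewrite /continuous_at g0.
have [dc Dc] := dg.
have {}dc : differentiable c (0 : R^o) by apply/derivable1_diffP.
have cc : c @ nbhs (0 : R^o) --> e0 by rewrite -c0; exact: differentiable_continuous.
have [H dH hH] := Ad_chart_differentiable Y.
apply: (@near_eq_is_derive _ _ _ (H \o c)).
  have n1 : \forall t \near (0 : R^o), cdom e (gamma t) by apply: gamma1; exact: near_cdom.
  have n2 : \forall t \near (0 : R^o), Ad e (cinv e (c t)) Y = H (c t) by exact: cc _ hH.
  by apply: filterS2 n1 n2 => t dt; rewrite /= cmapK.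
have dHc : differentiable (H \o c) (0 : R^o) by apply: differentiable_comp; rewrite ?c0.
split; first exact: diff_derivable.
rewrite deriveE// diff_comp ?c0//= -(deriveE _ dc) Dc -deriveE//.
rewrite -(near_eq_derive _ hH).
by have [_ _ /(_ X Y)[_ ->]] := eP.
Qed.

Lemma Ad_flow gamma X : one_parameter_subgroup A e gamma X ->
  is_flow X (fun t Y => Ad e (gamma t) Y).
Proof.
move=> gX; have [_ gD _] := gX.
have g0 : gamma 0 = 1%g.
  by apply: (@mulgI G (gamma 0)); rewrite -gD addr0 mulg1.
split=> [Y|t Y]; first by rewrite g0 Ad1.
have := is_derive_Ad (Ad e (gamma t) Y) gX; rewrite -(subrr t) => h.
have := is_derive_comp_shift h.
by under eq_fun do rewrite -AdM -gD subrK.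
Qed.

End LieGroup.

(** * Faces of an invariant body and of its section *)

Theorem theorem0p2 (R : realType) (g : normedLieAlgType R)
    (theta : 'End(g)) (G : topoGroupType) (A : set (chart G g))
    (e : chart G g) (K : set G) (E : set g) (a : {vspace g})
    (g_semisimple : lie_semisimple (L := g))
    (theta_cartan : cartan_involution theta)
    (G_lie_group : lie_group A)
    (G_lie_algebra : lie_algebra_of A e)
    (G_connected : connected [set: G])
    (K_maximal_compact : maximal_compact_subgroup K)
    (K_lie_algebra : lie_algebra_of_subgroup A e K = cartan_k theta)
    (E_sub_p : E `<=` cartan_p theta)
    (E_convex_body : convex_body E)
    (E_K_invariant : forall k x, K k -> E x -> E (Ad e k x))
    (a_maximal_abelian : maximal_abelian_in (cartan_p theta) a) :
  all_faces_exposed killing (cartan_p theta) E <->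
  all_faces_exposed killing [set` a] (E `&` [set` a]).
Proof.
have flowE X : cartan_k theta X ->
    exists2 phi, is_flow X phi & forall t x, E x -> E (phi t x).
  rewrite -K_lie_algebra => -[gamma gX Kg].
  exists (fun t Y => Ad e (gamma t) Y); first exact: Ad_flow gX.
  by move=> t x; exact: E_K_invariant.
have [_ ap _] := a_maximal_abelian.
split; first exact: exposed_section.
exact: exposed_of_section.
Qed.
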